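(* Let $\alpha$ and $\omega$ be an $R$-Cartan structure and an $(I,J,1)$-generalized Finsler structure, respectively, on the same 3-manifold $\Sigma$, such that the contact one-forms $\omega^1,\omega^3$ belong to the conformal class of the Cartan structure $\alpha$, i.e. $\omega^1=m\alpha^1$, $\omega^3=m\alpha^2$ for a positive smooth function $m$ on $\Sigma$ (the conformal factor). Then the linear transformation $A:T^*\Sigma\to T^*\Sigma$ with $\omega=A\alpha$, subject to the Foliation Condition, is given by $$\begin{pmatrix}\omega^1\\ \omega^2\\ \omega^3\end{pmatrix}=\begin{pmatrix}m&0&0\\ -\frac{m_2}{m}+Im&\frac{m_1}{m}+Jm&-1\\ 0&m&0\end{pmatrix}\begin{pmatrix}\alpha^1\\ \alpha^2\\ \alpha^3\end{pmatrix}.$$ Moreover, the structure function $R$ has to satisfy $$R\,\alpha^1\wedge\alpha^2=d\varphi+m^2\,\alpha^1\wedge\alpha^2+d( *d\log m),$$ where $\varphi=m(I\alpha^1+J\alpha^2)$.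
   Context: An $R$-Cartan structure on a 3-manifold $\Sigma$ ($R$ a smooth function) is a coframing $\alpha=(\alpha^1,\alpha^2,\alpha^3)$ with $d\alpha^1=\alpha^2\wedge\alpha^3$, $d\alpha^2=-\alpha^1\wedge\alpha^3$, $d\alpha^3=R\,\alpha^1\wedge\alpha^2$. An $(I,J,1)$-generalized Finsler structure ($I,J$ smooth functions) is a coframing $\omega=(\omega^1,\omega^2,\omega^3)$ with $d\omega^1=-I\omega^1\wedge\omega^3+\omega^2\wedge\omega^3$, $d\omega^2=-\omega^1\wedge\omega^3$, $d\omega^3=\omega^1\wedge\omega^2-J\omega^1\wedge\omega^3$. Subscripts denote directional derivatives with respect to $\alpha$: $df=f_1\alpha^1+f_2\alpha^2+f_3\alpha^3$. The Hodge operator is defined by $*d\log m=-\frac{m_2}{m}\alpha^1+\frac{m_1}{m}\alpha^2$. Foliation Condition: the foliation $\{\omega^1=0,\omega^3=0\}$ (geodesic foliation of $\omega$) coincides with the foliation $\{\alpha^1=0,\alpha^2=0\}$ (indicatrix foliation of $\alpha$). *)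

(* Defs.v *)
From HB Require Import structures.
From mathcomp Require Import all_boot all_order all_algebra.
From mathcomp Require Import all_classical all_reals all_analysis.

Set Implicit Arguments.
Unset Strict Implicit.
Unset Printing Implicit Defensive.

Import Order.TTheory GRing.Theory Num.Theory.
Import numFieldNormedType.Exports.

Local Open Scope classical_set_scope.
Local Open Scope ring_scope.

Section SmoothFunctions.
Context {K : realType}.
Implicit Types (U : set 'rV[K]_3) (f : 'rV[K]_3 -> K).

Definition partial (j : 'I_3) f : 'rV[K]_3 -> K :=
  fun x => 'D_(delta_mx 0 j) f x.

(* Meaningful for open U: f is k times continuously differentiable on U. *)
Fixpoint Ck (k : nat) U f : Prop :=
  (forall x, U x -> {for x, continuous f}) /\
  match k with
  | 0%N => True
  | k'.+1 => forall j : 'I_3,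
      (forall x, U x -> derivable f x (delta_mx 0 j)) /\
      Ck k' U (partial j f)
  end.

Definition smooth_on U f : Prop := forall k, Ck k U f.

End SmoothFunctions.

(* A 3-manifold is given by a smooth atlas (not required to be maximal).
   [chart_inv i] is only meaningful on the image of [chart_dom i]. *)
Record manifold3 (K : realType) := Manifold3 {
  carrier :> topologicalType;
  atlas : Type;
  chart_dom : atlas -> set carrier;
  chart : atlas -> carrier -> 'rV[K]_3;
  chart_inv : atlas -> 'rV[K]_3 -> carrier;
  manifold_hausdorff : hausdorff_space carrier;
  manifold_second_countable : @second_countable carrier;
  atlas_cover : forall p, exists i, chart_dom i p;
  chart_dom_open : forall i, open (chart_dom i);
  chart_image_open : forall i, open (chart i @` chart_dom i);
  chartK : forall i p, chart_dom i p -> chart_inv i (chart i p) = p;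
  chart_continuous : forall i p, chart_dom i p ->
    {for p, continuous (chart i)};
  chart_inv_continuous : forall i x, (chart i @` chart_dom i) x ->
    {for x, continuous (chart_inv i)};
  transition_smooth : forall i j (l : 'I_3),
    smooth_on (chart i @` (chart_dom i `&` chart_dom j))
              (fun x => chart j (chart_inv i x) 0 l)
}.

Section Forms.
Context {K : realType} {M : manifold3 K}.

Definition chart_image (i : atlas M) : set 'rV[K]_3 := chart i @` chart_dom i.

Definition smooth_fun (f : M -> K) : Prop :=
  forall i : atlas M, smooth_on (chart_image i) (f \o chart_inv i).

(* Differential forms are families of local expressions: [a i p] consists of
   the coefficients, at the point p, of the form a in the chart i.  Only the
   values at points p of [chart_dom i] matter, hence [eq_form] below.
   A one-form sum_l a_l dx^l is encoded by the row (a_l), a two-form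
   sum_(k < l) b_kl dx^k /\ dx^l by the alternating matrix (b_kl). *)
Definition local_form1 := atlas M -> M -> 'rV[K]_3.
Definition local_form2 := atlas M -> M -> 'M[K]_3.

Definition eq_form {V : Type} (a b : atlas M -> M -> V) : Prop :=
  forall i p, chart_dom i p -> a i p = b i p.

Definition add_form {V : zmodType} (a b : atlas M -> M -> V) :
  atlas M -> M -> V := fun i p => a i p + b i p.

Definition opp_form {V : zmodType} (a : atlas M -> M -> V) :
  atlas M -> M -> V := fun i p => - a i p.

Definition scale_form {V : lmodType K} (f : M -> K) (a : atlas M -> M -> V) :
  atlas M -> M -> V := fun i p => f p *: a i p.

(* Smooth sections of the cotangent bundle: the local expressions are smooth
   and are related on overlaps by a_k = sum_l a'_l (dx'^l / dx^k). *)
Definition one_form (a : local_form1) : Prop :=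
  (forall i (l : 'I_3),
     smooth_on (chart_image i) (fun x => a i (chart_inv i x) 0 l)) /\
  (forall i j p, chart_dom i p -> chart_dom j p -> forall k : 'I_3,
     a i p 0 k =
     \sum_(l < 3) a j p 0 l *
       partial k (fun x => chart j (chart_inv i x) 0 l) (chart i p)).

Definition wedge (a b : local_form1) : local_form2 := fun i p =>
  \matrix_(k, l) (a i p 0 k * b i p 0 l - a i p 0 l * b i p 0 k).

(* exterior derivative of functions *)
Definition d0 (f : M -> K) : local_form1 := fun i p =>
  \row_k partial k (f \o chart_inv i) (chart i p).

(* exterior derivative of one-forms *)
Definition d1 (a : local_form1) : local_form2 := fun i p =>
  \matrix_(k, l) (partial k (fun x => a i (chart_inv i x) 0 l) (chart i p) -
                  partial l (fun x => a i (chart_inv i x) 0 k) (chart i p)).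

End Forms.

Arguments local_form1 {K} M.
Arguments local_form2 {K} M.

Declare Scope form_scope.
Delimit Scope form_scope with F.
Infix "=" := eq_form : form_scope.
Infix "+" := add_form : form_scope.
Notation "- a" := (opp_form a) : form_scope.
Notation "a - b" := (add_form a (opp_form b)) : form_scope.
Notation "f *: a" := (scale_form f%R a) : form_scope.
Notation "a \w b" := (wedge a b)
  (at level 35, no associativity) : form_scope.

Section Structures.
Context {K : realType} {M : manifold3 K}.
Implicit Types (a w : 'I_3 -> local_form1 M) (m : M -> K).

(* Indices start at 0: [a 0], [a 1], [a 2] are the forms usually written with
   superscripts 1, 2, 3. *)
Definition coframing a : Prop :=
  (forall k, one_form (a k)) /\
  (forall i p, chart_dom i p -> row_free (\matrix_k a k i p)).

Definition Cartan_structure (R : M -> K) a : Prop :=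
  [/\ coframing a,
      (d1 (a 0) = a 1 \w a 2)%F,
      (d1 (a 1) = - (a 0 \w a 2))%F &
      (d1 (a 2) = R *: (a 0 \w a 1))%F].

Definition generalized_Finsler_structure (I J : M -> K) w : Prop :=
  [/\ coframing w,
      (d1 (w 0) = - (I *: (w 0 \w w 2)) + w 1 \w w 2)%F,
      (d1 (w 1) = - (w 0 \w w 2))%F &
      (d1 (w 2) = w 0 \w w 1 - J *: (w 0 \w w 2))%F].

(* The tangent directions, in the chart i, of the foliation {b = 0, c = 0}. *)
Definition foliation (b c : local_form1 M) : atlas M -> M -> set 'cV[K]_3 :=
  fun i p => [set v | b i p *m v = 0 /\ c i p *m v = 0].

Definition Foliation_Condition w a : Prop :=
  (foliation (w 0) (w 2) = foliation (a 0) (a 1))%F.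

(* f' 0, f' 1, f' 2 are the directional derivatives of f with respect to a;
   they are unique because a is a coframing. *)
Definition directional_derivatives a (f : M -> K) (f' : 'I_3 -> M -> K) :
  Prop := (d0 f = f' 0 *: a 0 + f' 1 *: a 1 + f' 2 *: a 2)%F.

(* *d log m, where m' are the directional derivatives of m *)
Definition hodge_dlog a m (m' : 'I_3 -> M -> K) : local_form1 M :=
  ((fun p => - (m' 1 p / m p)) *: a 0 + (fun p => m' 0 p / m p) *: a 1)%F.

(* The triple A a, for A a matrix-valued function. *)
Definition mul_coframe (A : M -> 'M[K]_3) a : 'I_3 -> local_form1 M :=
  fun k i p => \sum_(l < 3) A p k l *: a l i p.

Definition mx33 (rows : seq (seq K)) : 'M[K]_3 :=
  \matrix_(k, l) nth 0 (nth [::] rows k) l.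

End Structures.

(* Main.v *)
Require Import Defs.
From mathcomp Require Import all_boot all_order all_algebra.
From mathcomp Require Import all_classical all_reals all_analysis.
From mathcomp Require Import ring.
Import Order.TTheory GRing.Theory Num.Theory.
Import numFieldNormedType.Exports.
Local Open Scope ring_scope.

(** Both claims come from comparing two expressions for the exterior
    derivatives of the forms of omega.  Write omega^2 = x alpha^1 + y alpha^2
    + z alpha^3.  On the one hand omega^1 = m alpha^1 and omega^3 = m alpha^2,
    so the Leibniz rule ([d1_scale]) and the structure equations of alpha give
      d omega^1 = - m_2 alpha^12 - m_3 alpha^13 + m alpha^23,
      d omega^3 = m_1 alpha^12 - m alpha^13 - m_3 alpha^23,
    with alpha^kl the wedge of alpha^k and alpha^l (superscripts count from 1,
    as is customary).  On the other hand the
    structure equations of omega give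
      d omega^1 = (x m - I m^2) alpha^12 - z m alpha^23,
      d omega^3 = (y m - J m^2) alpha^12 + z m alpha^13.
    The alpha^kl are linearly independent ([wedge_coframe_free]), so x, y and z
    can be read off: this is [Finsler_middle_form].

    Its right-hand side is phi + *d log m - alpha^3.  Applying d, with
    d omega^2 = - m^2 alpha^12 and d alpha^3 = R alpha^12, yields the equation
    for R. *)

(** * Exterior calculus in charts *)

Section ExteriorDerivative.
Set Implicit Arguments.
Unset Strict Implicit.
Context {K : realType} {M : manifold3 K}.
Implicit Types (f g : M -> K) (a b : local_form1 M).

Definition chart_partial (i : atlas M) (k : 'I_3) f (p : M) : K :=
  partial k (f \o chart_inv i) (chart i p).

Definition chart_derivable (i : atlas M) f (p : M) : Prop :=
  forall k : 'I_3, derivable (f \o chart_inv i) (chart i p) (delta_mx 0 k).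

(** The hypothesis under which [d1] obeys the rules of calculus.  Unlike
    [one_form] it asks neither for higher derivatives nor for compatibility
    between charts, so that its closure under the operations on forms is
    immediate. *)
Definition derivable_form a : Prop := forall i p, chart_dom i p ->
  forall l : 'I_3, chart_derivable i (fun q => a i q 0 l) p.

Lemma chart_image_chart i (p : M) :
  chart_dom i p -> chart_image i (chart i p).
Proof. by move=> ip; exists p. Qed.

Lemma d0E f i (p : M) k : d0 f i p 0 k = chart_partial i k f p.
Proof. by rewrite mxE. Qed.

Lemma d1E a i (p : M) k l : d1 a i p k l =
  chart_partial i k (fun q => a i q 0 l) p -
  chart_partial i l (fun q => a i q 0 k) p.
Proof. by rewrite mxE. Qed.

Lemma wedgeE a b i (p : M) k l :
  (a \w b)%F i p k l = a i p 0 k * b i p 0 l - a i p 0 l * b i p 0 k.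
Proof. by rewrite mxE. Qed.

Lemma add_form_mxE n1 n2 (u v : atlas M -> M -> 'M[K]_(n1, n2)) i p k l :
  (u + v)%F i p k l = u i p k l + v i p k l.
Proof. by rewrite mxE. Qed.

Lemma opp_form_mxE n1 n2 (u : atlas M -> M -> 'M[K]_(n1, n2)) i p k l :
  (- u)%F i p k l = - u i p k l.
Proof. by rewrite mxE. Qed.

Lemma scale_form_mxE n1 n2 f (u : atlas M -> M -> 'M[K]_(n1, n2)) i p k l :
  (f *: u)%F i p k l = f p * u i p k l.
Proof. by rewrite mxE. Qed.

Lemma eq_chart_partial i k f g (p : M) : chart_dom i p ->
  (forall q, chart_dom i q -> f q = g q) ->
  chart_partial i k f p = chart_partial i k g p.
Proof.
move=> ip fg; apply: near_eq_derive.
have := open_nbhs_nbhs (conj (@chart_image_open K M i) (chart_image_chart ip)).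
apply: filterS => _ [q iq <-] /=.
by rewrite chartK// fg.
Qed.

Lemma chart_partialD i k f g (p : M) :
  chart_derivable i f p -> chart_derivable i g p ->
  chart_partial i k (fun q => f q + g q) p =
  chart_partial i k f p + chart_partial i k g p.
Proof. by move=> /(_ k) df /(_ k) dg; exact: (deriveD df dg). Qed.

Lemma chart_partialN i k f (p : M) : chart_derivable i f p ->
  chart_partial i k (fun q => - f q) p = - chart_partial i k f p.
Proof. by move=> /(_ k) df; exact: (deriveN df). Qed.

Lemma chart_partialM i k f g (p : M) : chart_dom i p ->
  chart_derivable i f p -> chart_derivable i g p ->
  chart_partial i k (fun q => f q * g q) p =
  f p * chart_partial i k g p + g p * chart_partial i k f p.
Proof.
move=> ip /(_ k) df /(_ k) dg.
by have /= := deriveM df dg; rewrite chartK.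
Qed.

Lemma smooth_chart_derivable f i (p : M) :
  smooth_fun f -> chart_dom i p -> chart_derivable i f p.
Proof.
by move=> /(_ i 1%N)[_ df] ip k; apply: (df k).1; exact: chart_image_chart.
Qed.

Lemma one_form_derivable a : one_form a -> derivable_form a.
Proof.
move=> [/[swap] _ sa] i p ip l k.
by have [_ da] := sa i l 1%N; apply: (da k).1; exact: chart_image_chart.
Qed.

Lemma derivable_formD a b :
  derivable_form a -> derivable_form b -> derivable_form (a + b)%F.
Proof.
move=> da db i p ip l k.
have -> : (fun q => (a + b)%F i q 0 l) \o chart_inv i =
    ((fun q => a i q 0 l) \o chart_inv i) + ((fun q => b i q 0 l) \o chart_inv i).
  by apply/funext => x /=; rewrite !mxE.
by apply: derivableD; [exact: da|exact: db].
Qed.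

Lemma derivable_formN a : derivable_form a -> derivable_form (- a)%F.
Proof.
move=> da i p ip l k.
have -> : (fun q => (- a)%F i q 0 l) \o chart_inv i =
    - ((fun q => a i q 0 l) \o chart_inv i).
  by apply/funext => x /=; rewrite !mxE.
by apply: derivableN; exact: da.
Qed.

Lemma derivable_form_scale f a :
  smooth_fun f -> derivable_form a -> derivable_form (f *: a)%F.
Proof.
move=> sf da i p ip l k.
have -> : (fun q => (f *: a)%F i q 0 l) \o chart_inv i =
    (f \o chart_inv i) * ((fun q => a i q 0 l) \o chart_inv i).
  by apply/funext => x /=; rewrite !mxE.
by apply: derivableM; [exact: smooth_chart_derivable|exact: da].
Qed.

(** Chart images are open, so the partial derivatives at a point of a chart
    only see the coefficients on the domain of that chart. *)
Lemma eq_d1 a b : (a = b)%F -> (d1 a = d1 b)%F.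
Proof.
move=> ab i p ip; apply/matrixP => k l; rewrite !d1E.
by congr (_ - _); apply: eq_chart_partial => // q iq; rewrite ab.
Qed.

Lemma d1D a b : derivable_form a -> derivable_form b ->
  (d1 (a + b) = d1 a + d1 b)%F.
Proof.
move=> da db i p ip; apply/matrixP => k l; rewrite add_form_mxE !d1E.
have e k' l' : chart_partial i k' (fun q => (a + b)%F i q 0 l') p =
    chart_partial i k' (fun q => a i q 0 l') p +
    chart_partial i k' (fun q => b i q 0 l') p.
  rewrite -chart_partialD; [|exact: da|exact: db].
  by apply: eq_chart_partial => // q _; rewrite mxE.
by rewrite !e; ring.
Qed.

Lemma d1N a : derivable_form a -> (d1 (- a) = - d1 a)%F.
Proof.
move=> da i p ip; apply/matrixP => k l; rewrite opp_form_mxE !d1E.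
have e k' l' : chart_partial i k' (fun q => (- a)%F i q 0 l') p =
    - chart_partial i k' (fun q => a i q 0 l') p.
  rewrite -chart_partialN; last exact: da.
  by apply: eq_chart_partial => // q _; rewrite mxE.
by rewrite !e; ring.
Qed.

Lemma d1_scale f a : smooth_fun f -> derivable_form a ->
  (d1 (f *: a) = d0 f \w a + f *: d1 a)%F.
Proof.
move=> sf da i p ip; apply/matrixP => k l.
rewrite add_form_mxE scale_form_mxE wedgeE !d1E !d0E.
have e k' l' : chart_partial i k' (fun q => (f *: a)%F i q 0 l') p =
    f p * chart_partial i k' (fun q => a i q 0 l') p +
    a i p 0 l' * chart_partial i k' f p.
  rewrite -chart_partialM //; [|exact: smooth_chart_derivable|exact: da].
  by apply: eq_chart_partial => // q _; rewrite mxE.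
by rewrite !e; ring.
Qed.

End ExteriorDerivative.

(** * Linear algebra of a coframe *)

Section Coframes.
Set Implicit Arguments.
Unset Strict Implicit.
Context {K : realType} {M : manifold3 K}.
Implicit Types (a : 'I_3 -> local_form1 M).

Lemma mx33E (r : seq (seq K)) k l : mx33 r k l = nth 0 (nth [::] r k) l.
Proof. by rewrite mxE. Qed.

(** The two-form is B^T C B, where the rows of B are the coframe and C is the
    alternating matrix with entries x, y, z above the diagonal; B is
    invertible. *)
Lemma wedge_coframe_free a i (p : M) (x y z : K) :
  row_free (\matrix_k a k i p) ->
  x *: (a 0 \w a 1)%F i p + y *: (a 0 \w a 2)%F i p +
    z *: (a 1 \w a 2)%F i p = 0 ->
  [/\ x = 0, y = 0 & z = 0].
Proof.
set B := \matrix_k a k i p; rewrite row_free_unit => uB.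
pose C := mx33 [:: [:: 0; x; y]; [:: - x; 0; z]; [:: - y; - z; 0]].
have -> : x *: (a 0 \w a 1)%F i p + y *: (a 0 \w a 2)%F i p +
    z *: (a 1 \w a 2)%F i p = B^T *m C *m B.
  apply/matrixP => k l; rewrite !mxE !big_ord_recl big_ord0.
  rewrite !mxE !big_ord_recl !big_ord0 !mxE /=.
  have -> : lift ord0 ord0 = 1 :> 'I_3 by exact/val_inj.
  have -> : lift ord0 (lift ord0 ord0) = 2 :> 'I_3 by exact/val_inj.
  have -> : ord0 = 0 :> 'I_3 by exact/val_inj.
  by ring.
move=> BCB.
have C0 : C = 0.
  have uBT : B^T \in unitmx by rewrite unitmx_tr.
  by rewrite -(mulmxK uB C) -(mulKmx uBT (C *m B)) [B^T *m _]mulmxA BCB mulmx0 mul0mx.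
have e k l : C k l = 0 by rewrite C0 mxE.
by split; [have := e 0 1|have := e 0 2|have := e 1 2]; rewrite mx33E.
Qed.

Lemma mul_coframeE (A : M -> 'M[K]_3) a k i (p : M) :
  mul_coframe A a k i p =
  A p k 0 *: a 0 i p + A p k 1 *: a 1 i p + A p k 2 *: a 2 i p.
Proof.
rewrite /mul_coframe !big_ord_recl big_ord0 addr0 addrA.
by congr (_ *: a _ i p + _ *: a _ i p + _ *: a _ i p);
  [congr (A p k _)| |congr (A p k _)|]; exact/val_inj.
Qed.

Lemma mul_coframe_mx (A : M -> 'M[K]_3) a i (p : M) :
  \matrix_k mul_coframe A a k i p = A p *m \matrix_k a k i p.
Proof.
apply/row_matrixP => k; rewrite rowK row_mul mulmx_sum_row.
by apply: eq_bigr => l _; rewrite rowK mxE.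
Qed.

(** The matrix relating two triples of forms does not depend on a chart, but
    its uniqueness can be tested in any single chart around the point. *)
Lemma mul_coframe_inj (A B : M -> 'M[K]_3) a : coframing a ->
  (forall k, (mul_coframe A a k = mul_coframe B a k)%F) ->
  forall p, A p = B p.
Proof.
move=> [_ free_a] AB p; have [i ip] := atlas_cover p.
apply: (row_free_inj (free_a i p ip)); rewrite -!mul_coframe_mx.
by apply/row_matrixP => k; rewrite !rowK; exact: AB.
Qed.

Lemma coframe_span a i (p : M) (w : 'rV[K]_3) :
  row_free (\matrix_k a k i p) ->
  exists x y z,
    w = x *: a 0 i p + y *: a 1 i p + z *: a 2 i p :> 'rV[K]_3.
Proof.
rewrite row_free_unit => ua.
pose c := w *m invmx (\matrix_k a k i p).
exists (c 0 0), (c 0 1), (c 0 2).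
rewrite -(mulmxKV ua w) -/c mulmx_sum_row !big_ord_recl big_ord0 addr0 addrA.
rewrite !rowK.
by congr (c 0 _ *: a _ i p + c 0 _ *: a _ i p + c 0 _ *: a _ i p);
  exact/val_inj.
Qed.

End Coframes.

(** * Comparison of the two structures *)

Section MiddleForm.
Set Implicit Arguments.
Unset Strict Implicit.
Context {K : realType} {M : manifold3 K}.

(** In d omega^1 and d omega^3 the Finsler structure equations involve omega^2
    only through its wedge products with omega^1 and omega^3, which are
    multiples of alpha^1 and alpha^2; hence these two equations are linear in
    the coefficients of omega^2 and determine all three of them. *)
Lemma Finsler_middle_form (R I J : M -> K)
  (alpha omega : 'I_3 -> local_form1 M) (m : M -> K) (m' : 'I_3 -> M -> K) :
  Cartan_structure R alpha -> generalized_Finsler_structure I J omega ->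
  smooth_fun m -> (forall p, 0 < m p) -> directional_derivatives alpha m m' ->
  (omega 0 = m *: alpha 0)%F -> (omega 2 = m *: alpha 1)%F ->
  (omega 1 = (fun p => - (m' 1 p / m p) + I p * m p)%R *: alpha 0 +
             (fun p => m' 0 p / m p + J p * m p)%R *: alpha 1 - alpha 2)%F.
Proof.
move=> [[alpha1 free_alpha] da0 da1 _] [_ dw0 _ dw2] sm m_gt0 dm w0 w2 i p ip.
have [x [y [z w1]]] := coframe_span (omega 1 i p) (free_alpha i p ip).
have m0 : m p != 0 by rewrite gt_eqF.
have dalpha k : derivable_form (alpha k) by exact: one_form_derivable.
have dw0' := etrans (esym (dw0 i p ip)) (etrans (eq_d1 w0 ip)
  (d1_scale sm (dalpha 0) ip)).
have dw2' := etrans (esym (dw2 i p ip)) (etrans (eq_d1 w2 ip)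
  (d1_scale sm (dalpha 1) ip)).
(* The difference of the two expressions for d omega^1. *)
have [x_eq _ z_eq] : [/\ m' 1 p + x * m p - I p * m p ^+ 2 = 0,
    m' 2 p = 0 & - (z * m p) - m p = 0].
  apply: (wedge_coframe_free (free_alpha i p ip)).
  apply/matrixP => k l; move/matrixP/(_ k l): dw0'.
  rewrite /add_form /opp_form /scale_form /wedge da0 // w1 w0 // w2 // dm //.
  rewrite !mxE => /eqP; rewrite -subr_eq0 => /eqP e.
  by rewrite -[RHS]e; ring.
(* The difference of the two expressions for d omega^3. *)
have [y_eq _ _] : [/\ m p * y - J p * m p ^+ 2 - m' 0 p = 0,
    m p * z + m p = 0 & m' 2 p = 0].
  apply: (wedge_coframe_free (free_alpha i p ip)).
  apply/matrixP => k l; move/matrixP/(_ k l): dw2'.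
  rewrite /add_form /opp_form /scale_form /wedge da1 // w1 w0 // w2 // dm //.
  rewrite !mxE => /eqP; rewrite -subr_eq0 => /eqP e.
  by rewrite -[RHS]e; ring.
have -> : omega 1 i p =
  (- (m' 1 p / m p) + I p * m p) *: alpha 0 i p +
  (m' 0 p / m p + J p * m p) *: alpha 1 i p + (-1) *: alpha 2 i p.
  rewrite w1; congr (_ *: _ + _ *: _ + _ *: _); apply: (mulIf m0).
  - apply/eqP; rewrite -subr_eq0 -x_eq; apply/eqP; field.
    exact: m0.
  - apply/eqP; rewrite -subr_eq0 -y_eq; apply/eqP; field.
    exact: m0.
  - apply/eqP; rewrite -subr_eq0 -oppr_eq0 -z_eq; apply/eqP; ring.
by rewrite scaleN1r.
Qed.

End MiddleForm.

Theorem theorem3p3 (K : realType) (M : manifold3 K) (R I J : M -> K)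
  (alpha omega : 'I_3 -> local_form1 M) (m : M -> K) (m' : 'I_3 -> M -> K)
  (R_smooth : smooth_fun R) (I_smooth : smooth_fun I) (J_smooth : smooth_fun J)
  (alpha_Cartan : Cartan_structure R alpha)
  (omega_Finsler : generalized_Finsler_structure I J omega)
  (m_smooth : smooth_fun m) (m_gt0 : forall p, 0 < m p)
  (m'_derivatives : directional_derivatives alpha m m')
  (omega0E : (omega 0 = m *: alpha 0)%F) (omega2E : (omega 2 = m *: alpha 1)%F)
  (geodesic_foliation : Foliation_Condition omega alpha) :
  let phi := (m *: (I *: alpha 0 + J *: alpha 1))%F in
  (forall A : M -> 'M[K]_3,
     (forall k, (omega k = mul_coframe A alpha k)%F) <->
     (forall p, A p = mx33
        [:: [:: m p; 0; 0];
            [:: - (m' 1 p / m p) + I p * m p; m' 0 p / m p + J p * m p; -1];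
            [:: 0; m p; 0]])) /\
  (R *: (alpha 0 \w alpha 1) =
     d1 phi + (fun p => m p ^+ 2) *: (alpha 0 \w alpha 1) + d1 (hodge_dlog alpha m m'))%F.
Proof.
move=> phi.
have omega1E := Finsler_middle_form alpha_Cartan omega_Finsler m_smooth m_gt0
  m'_derivatives omega0E omega2E.
have [[alpha1 free_alpha] _ _ da2] := alpha_Cartan.
have [[omega1 _] _ dw1 _] := omega_Finsler.
split.
  pose A0 p := mx33
    [:: [:: m p; 0; 0];
        [:: - (m' 1 p / m p) + I p * m p; m' 0 p / m p + J p * m p; -1];
        [:: 0; m p; 0]].
  have omegaE k : (omega k = mul_coframe A0 alpha k)%F.
    move=> i p ip; rewrite mul_coframeE !mx33E.
    have [->|->|->] : [\/ k = 0, k = 1 | k = 2].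
      by case: k => -[|[|[|//]]] ?; [apply: Or31|apply: Or32|apply: Or33];
        exact/val_inj.
    - by rewrite omega0E //= !scale0r !addr0.
    - by rewrite omega1E //= scaleN1r.
    - by rewrite omega2E //= !scale0r addr0 add0r.
  move=> A; split=> [AE|AE k i p ip]; last first.
    by rewrite omegaE // !mul_coframeE AE.
  apply: (mul_coframe_inj (conj alpha1 free_alpha)) => k i p ip.
  by rewrite -AE // omegaE.
have dphi : derivable_form phi.
  apply: derivable_form_scale => //; apply: derivable_formD;
    by apply: derivable_form_scale => //; exact: one_form_derivable.
(* This gives d of *d log m from forms already known to be differentiable,
   without differentiating m' or the quotients by m. *)
have hodgeE : (hodge_dlog alpha m m' = omega 1 + alpha 2 - phi)%F.
  move=> i p ip; apply/rowP => l.
  by rewrite /add_form omega1E // !mxE; ring.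
have dhodge :
    (d1 (hodge_dlog alpha m m') = d1 (omega 1) + d1 (alpha 2) - d1 phi)%F.
  have dw := one_form_derivable (omega1 1).
  have da := one_form_derivable (alpha1 2).
  move=> i p ip; rewrite (eq_d1 hodgeE ip).
  rewrite (d1D (derivable_formD dw da) (derivable_formN dphi) ip).
  by rewrite /add_form (d1D dw da ip) (d1N dphi ip).
(* Here d phi cancels, and the equation becomes
   R alpha^12 = m^2 alpha^12 + d omega^2 + d alpha^3. *)
move=> i p ip; apply/matrixP => k l.
rewrite /add_form dhodge // /add_form /opp_form dw1 // da2 //.
rewrite /opp_form /scale_form /wedge omega0E // omega2E //.
by rewrite !mxE; ring.
Qed.
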